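(* Let $f=\frac1n\sum_{i=1}^n f_i$ with $f_i:\mathbb{R}^d\to\mathbb{R}$ twice differentiable, and suppose every $f_i$ is Lipschitz continuous with constant $L_0$. Let $\delta\in(0,1)$ and $\epsilon_{\mathbf g}>0$. For each $t\ge 0$ let $\mathbf{g}_t=\frac{1}{|\mathcal{S}_{\mathbf g,t}|}\sum_{i\in\mathcal{S}_{\mathbf g,t}}\nabla f_i(\mathbf{x}_t)$ be the subsampled gradient at the iterate $\mathbf{x}_t\in\mathbb{R}^d$. If $$|\mathcal{S}_{\mathbf g,t}|\ \ge\ \frac{4L_0^2\left(1+2\sqrt{\log\frac1\delta}\right)^2}{\epsilon_{\mathbf g}^2},$$ then, for all $t\ge 0$, with probability at least $1-\delta$, $$\|\mathbf{g}_t-\nabla f(\mathbf{x}_t)\|\le \epsilon_{\mathbf g}.$$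
   Context: $\|\cdot\|$ is the Euclidean norm. The index (multi)set $\mathcal{S}_{\mathbf g,t}$ is formed of data indices drawn independently and uniformly from $\{1,\dots,n\}$ at iteration $t$, independently of $\mathbf{x}_t$, so that $\mathbf{g}_t$ is an unbiased estimator of $\nabla f(\mathbf{x}_t)$; $|\mathcal{S}_{\mathbf g,t}|$ is the number of draws. The probability is over this sampling, and the guarantee is understood for each iteration $t$. *)

(* Defs.v *)
From mathcomp Require Import all_boot all_order all_algebra.
From mathcomp Require Import all_classical all_reals all_analysis.
Import Order.TTheory GRing.Theory Num.Theory.
Import numFieldNormedType.Exports.

Set Implicit Arguments.
Unset Strict Implicit.
Unset Printing Implicit Defensive.

Local Open Scope classical_set_scope.
Local Open Scope ring_scope.

Section Calculus.
Context {R : realType}.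
Implicit Type d n m : nat.

(* The library norm on 'rV[R]_d is the sup norm. It induces the same topology
   and the same notion of differentiability as enorm, but not the same
   Lipschitz constants. *)
Definition enorm d (v : 'rV[R]_d) : R := Num.sqrt (\sum_(j < d) v ord0 j ^+ 2).

Definition grad d (f : 'rV[R]_d -> R) (x : 'rV[R]_d) : 'rV[R]_d :=
  \row_(j < d) 'D_(delta_mx ord0 j) f x.

(* Frechet differentiability of f and of its gradient map, at every point. *)
Definition twice_differentiable d (f : 'rV[R]_d -> R) : Prop :=
  (forall x, differentiable f x) /\ (forall x, differentiable (grad f) x).

Definition elipschitz d (L : R) (f : 'rV[R]_d -> R) : Prop :=
  forall x y, `|f x - f y| <= L * enorm (x - y).

Definition average d n (f : 'I_n -> 'rV[R]_d -> R) (x : 'rV[R]_d) : R :=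
  n%:R^-1 * \sum_(i < n) f i x.

(* A sample is the family s of its m draws, so repeated indices are counted
   with multiplicity. *)
Definition subsampled_grad d n (f : 'I_n -> 'rV[R]_d -> R) m
    (s : 'I_m -> 'I_n) (x : 'rV[R]_d) : 'rV[R]_d :=
  m%:R^-1 *: \sum_(k < m) grad (f (s k)) x.

Definition borel d : set (set 'rV[R]_d) := <<s open >>.

End Calculus.
Arguments borel : clear implicits.

Section Probability.
Context {dT : measure_display} {T : measurableType dT} {R : realType}.
Variable P : probability T R.

(* Measurability with respect to a set system G on the codomain, for codomains
   without a measurableType structure: 'rV[R]_d, and 'I_n, which is not
   pointed. *)
Definition random_element (U : Type) (G : set (set U)) (X : T -> U) : Prop :=
  forall B, G B -> measurable (X @^-1` B).

Definition sigma_of (U : Type) (G : set (set U)) (X : T -> U) : set (set T) :=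
  preimage_set_system [set: T] X G.

Definition mutually_independent (I : finType) (E : I -> set (set T)) : Prop :=
  forall (J : {set I}) (A : I -> set T),
    (forall i, i \in J -> E i (A i)) ->
    P (\bigcap_(i in [set` J]) A i) = (\prod_(i in J) P (A i))%E.

Definition independent (E F : set (set T)) : Prop :=
  forall A B, E A -> F B -> P (A `&` B) = (P A * P B)%E.

Definition uniform_index n (X : T -> 'I_n) : Prop :=
  forall i, P (X @^-1` [set i]) = (n%:R^-1)%:E.

(* Independent uniform draws with replacement, jointly independent of x. *)
Definition uniform_sample d n m (S : 'I_m -> T -> 'I_n) (x : T -> 'rV[R]_d)
    : Prop :=
  [/\ forall k, random_element discrete_measurable (S k),
      forall k, uniform_index (S k),
      mutually_independent (fun k => sigma_of discrete_measurable (S k)) &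
      independent
        (sigma_of discrete_measurable (fun w => [ffun k => S k w]))
        (sigma_of (borel R d) x)].

End Probability.

(* Main.v *)
(* Condition on the iterate: for a fixed point the question becomes a tail bound
   for |Z_1 + ... + Z_m|, where the Z_k are independent and uniform among the
   centred gradients X_i, which satisfy |X_i| <= M and |X_i - X_j| <= M with
   M = 2 L0.  View w -> w + Z_1 + ... + Z_m as a random walk with Markov operator
   A.  The norm is 1-Lipschitz, so it changes by at most M between two choices of
   an increment, and A preserves this property; since e^y <= y + e^(y^2), each
   step costs at most a factor e^((lambda M)^2) in the exponential moment of
   lambda |.|.  As the mean of |Z_1 + ... + Z_m| is at most M sqrt m, Chernoff's
   inequality with lambda = a / (M sqrt m) bounds the probability that the norm
   exceeds M sqrt m (1 + 2 a) by e^(-a^2), which is delta for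
   a = sqrt (ln (1 / delta)). *)
Require Import Defs.
From mathcomp Require Import all_boot all_order all_algebra.
From mathcomp Require Import all_classical all_reals all_analysis.
From mathcomp Require Import ring lra measurable_realfun.
Import Order.TTheory GRing.Theory Num.Theory.
Import numFieldNormedType.Exports.

Set Implicit Arguments.
Unset Strict Implicit.
Unset Printing Implicit Defensive.

Local Open Scope classical_set_scope.
Local Open Scope ring_scope.

(** * Elementary bounds on the exponential *)

Lemma expR_le_quadratic (R : realType) (y : R) :
  y <= 1 -> expR y <= 1 + y + y ^+ 2.
Proof.
(* It suffices that [h >= 1] up to 1: [h 0 = 1], and the derivative [z (1 - z) e^(-z)] makes [h]
   decrease on the negatives and increase on [0, 1]. *)
pose h (z : R) := (1 + z + z ^+ 2) * expR (- z).
have dh (z : R) : is_derive z 1 h (z * (1 - z) * expR (- z)).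
  by apply: is_derive_eq; rewrite /GRing.scale /=; ring.
have ch : continuous (h : R -> R).
  by move=> z; apply/differentiable_continuous/derivable1_diffP; case: (dh z).
move=> y1; suff : 1 <= h y.
  by rewrite /h expRN lter_pdivlMr ?expR_gt0// mul1r.
have h0 : h 0 = 1 by rewrite /h oppr0 expR0; ring.
have [y0|y0] := leP 0 y.
  have [|c cI] := MVT_segment y0 (fun z _ => dh z); first exact: continuous_subspaceT.
  rewrite h0 -subr_ge0 => ->; move: cI; rewrite in_itv/= => /andP[c0 cy].
  by rewrite !mulr_ge0 ?expR_ge0 ?subr_ge0// (le_trans cy).
have [|c cI] := MVT_segment (ltW y0) (fun z _ => dh z); first exact: continuous_subspaceT.
rewrite h0 -subr_le0 => ->; move: cI; rewrite in_itv/= => /andP[_ c0].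
rewrite mulr_le0_ge0 ?subr_ge0 ?(ltW y0)// mulr_le0_ge0 ?expR_ge0//.
by rewrite mulr_le0_ge0// subr_ge0 (le_trans c0).
Qed.

(** Up to 1, combine the quadratic bound with [1 + y^2 <= e^(y^2)]; beyond 1, already [y <= y^2]. *)
Lemma expR_le_add_sqr (R : realType) (y : R) : expR y <= y + expR (y ^+ 2).
Proof.
have [y1|y1] := leP y 1.
  apply: le_trans (expR_le_quadratic y1) _.
  by rewrite -addrA addrCA lerD2l expR_ge1Dx.
have y0 : 0 <= y by exact: le_trans (ltW y1).
apply: (@le_trans _ _ (expR (y ^+ 2))); last by rewrite lerDr.
by rewrite ler_expR expr2 ler_peMr// ltW.
Qed.

(** * Exponential moments of a random walk *)

Section RandomWalk.
Variables (R : realType) (I : finType) (V : zmodType) (X : I -> V).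
Hypothesis I0 : (0 < #|I|)%N.

Let cardI_gt0 : 0 < #|I|%:R :> R. Proof. by rewrite ltr0n. Qed.

(* The Markov operator of the random walk whose increments are uniformly
   distributed among the X i. *)
Definition step (phi : V -> R) (w : V) : R :=
  #|I|%:R^-1 * \sum_i phi (w + X i).

Lemma ler_step (phi psi : V -> R) :
  (forall w, phi w <= psi w) -> forall w, step phi w <= step psi w.
Proof. by move=> le w; rewrite ler_wpM2l ?invr_ge0 ?ler0n// ler_sum. Qed.

Lemma ler_iter_step m (phi psi : V -> R) :
  (forall w, phi w <= psi w) -> forall w, iter m step phi w <= iter m step psi w.
Proof. by elim: m => //= m IH le w; apply/ler_step/IH. Qed.

Lemma iter_stepZ m (c : R) (phi : V -> R) :
  iter m step (c \*o phi) = c \*o iter m step phi.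
Proof.
elim: m => //= m ->; apply/funext => w.
by rewrite /step /= -mulr_sumr mulrCA.
Qed.

Lemma step_cst (c : R) w : step (fun=> c) w = c.
Proof.
rewrite /step sumr_const -[c *+ _]mulr_natl mulrA mulVf ?mul1r//.
by rewrite gt_eqF.
Qed.

Lemma stepD (phi psi : V -> R) w :
  step (fun z => phi z + psi z) w = step phi w + step psi w.
Proof. by rewrite /step big_split mulrDr. Qed.

(** Conditioning on the first increment turns an average over all index sequences into an iterate of
    [step], to be bounded one step at a time. *)
Lemma walk_avgE m (phi : V -> R) w :
  (#|I| ^ m)%:R^-1 * \sum_(s : {ffun 'I_m -> I}) phi (w + \sum_k X (s k)) =
  iter m step phi w.
Proof.
elim: m w => [|m IH] w.
  rewrite (eq_bigr (fun=> phi w)) => [|s _]; last by rewrite big_ord0 addr0.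
  by rewrite expn0 invr1 mul1r sumr_const card_ffun card_ord expn0.
rewrite iterS /step.
under [in RHS]eq_bigr do rewrite -IH.
rewrite -mulr_sumr mulrA -invfM -natrM expnS; congr (_ * _).
(* A sequence of length [m.+1] is a first index with a tail of length [m]; [split] inverts
   [cons]. *)
pose cons (p : I * {ffun 'I_m -> I}) : {ffun 'I_m.+1 -> I} :=
  [ffun k => if unlift ord0 k is Some j then p.2 j else p.1].
pose split (s : {ffun 'I_m.+1 -> I}) := (s ord0, [ffun j => s (lift ord0 j)]).
rewrite pair_big /= (reindex cons) /=; last first.
  exists split => [[i s] _|s _].
    rewrite /split ffunE unlift_none; congr pair.
    by apply/ffunP=> j; rewrite !ffunE liftK.
  by apply/ffunP=> k; rewrite ffunE; case: unliftP => [j ->|->]//=; rewrite ffunE.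
apply: eq_bigr => -[i s] _; congr phi.
rewrite big_ord_recl ffunE unlift_none /= addrA; congr (_ + _).
by apply: eq_bigr => j _; rewrite ffunE liftK.
Qed.

(** A bounded-differences condition: only points reached from the same [w] are compared, so for a
    1-Lipschitz [phi] the diameter of the increments serves as [M]. *)
Definition oscillation_le (M : R) (phi : V -> R) :=
  forall w i j, `|phi (w + X i) - phi (w + X j)| <= M.

(** Give the walks at [w + X i] and [w + X j] the same increment [X k]; as addition commutes, each
    pair of terms is compared from [w + X k]. *)
Lemma oscillation_le_step M phi :
  oscillation_le M phi -> oscillation_le M (step phi).
Proof.
move=> osc w i j; rewrite /step -mulrBr -sumrB normrM gtr0_norm ?invr_gt0//.
rewrite mulrC ler_pdivrMr//; apply: le_trans (ler_norm_sum _ _ _) _.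
rewrite mulr_natr -sumr_const ler_sum// => k _.
by rewrite (addrAC w (X i)) (addrAC w (X j)).
Qed.

(* Write phi (w + X i) as its mean plus a deviation; the linear term of
   expR_le_add_sqr averages out. *)
Lemma step_expR_le M phi w : oscillation_le M phi ->
  step (expR \o phi) w <= expR (M ^+ 2) * expR (step phi w).
Proof.
move=> osc; set mu := step phi w.
pose dev i := phi (w + X i) - mu.
have dev_sum : \sum_i dev i = 0.
  rewrite sumrB sumr_const -[mu *+ _]mulr_natl /mu /step mulrA mulfV ?gt_eqF//.
  by rewrite mul1r subrr.
have dev_le i : `|dev i| <= M.
  rewrite /dev /mu -[phi _](step_cst _ w) -mulrBr -sumrB normrM.
  rewrite gtr0_norm ?invr_gt0// mulrC ler_pdivrMr//.
  apply: le_trans (ler_norm_sum _ _ _) _.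
  by rewrite mulr_natr -sumr_const ler_sum.
rewrite /step mulrC ler_pdivrMr//.
apply: (@le_trans _ _ (\sum_i expR mu * (dev i + expR (M ^+ 2)))).
  apply: ler_sum => i _ /=.
  rewrite (_ : phi _ = mu + dev i); last by rewrite /dev [mu + _]addrC subrK.
  rewrite expRD ler_pM2l ?expR_gt0//; apply: le_trans (expR_le_add_sqr _) _.
  rewrite lerD2l ler_expR -[_ ^+ 2]ger0_norm ?sqr_ge0// normrX.
  by rewrite lerXn2r ?nnegrE ?(le_trans _ (dev_le i)).
rewrite -mulr_sumr big_split /= dev_sum add0r sumr_const -[_ *+ #|_|]mulr_natr.
by rewrite mulrA [expR mu * _]mulrC.
Qed.

(** The innermost [step] is peeled off, so that induction applies to [step phi], which satisfies the
    same oscillation bound. *)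
Lemma iter_step_expR_le m M phi w : oscillation_le M phi ->
  iter m step (expR \o phi) w <=
  expR (m%:R * M ^+ 2) * expR (iter m step phi w).
Proof.
elim: m phi => [|m IH] phi osc; first by rewrite mul0r expR0 mul1r.
rewrite !iterSr.
apply: (@le_trans _ _ (iter m step (expR (M ^+ 2) \*o (expR \o step phi)) w)).
  by apply: ler_iter_step => z; apply: step_expR_le.
rewrite iter_stepZ /= -natr1 mulrDl mul1r expRD [_ * expR (M ^+ 2)]mulrC -mulrA.
by rewrite ler_pM2l ?expR_gt0// IH//; exact: oscillation_le_step.
Qed.

End RandomWalk.

(** * The Euclidean norm *)

Section EuclideanNorm.
Variables (R : realType) (d : nat).
Implicit Types u v : 'rV[R]_d.

Lemma enorm_ge0 u : 0 <= enorm u.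
Proof. exact: sqrtr_ge0. Qed.

Lemma sqr_enorm u : enorm u ^+ 2 = \sum_j u ord0 j ^+ 2.
Proof. by rewrite sqr_sqrtr// sumr_ge0// => j _; exact: sqr_ge0. Qed.

Lemma enorm0_eq0 u : enorm u = 0 -> u = 0.
Proof.
move=> u0; have /eqP := sqr_enorm u.
rewrite u0 expr0n/= eq_sym psumr_eq0 => [/allP u_eq0|j _]; last exact: sqr_ge0.
apply/rowP => j; rewrite mxE; apply/eqP; rewrite -sqrf_eq0.
by have := u_eq0 j; rewrite mem_index_enum => /(_ isT).
Qed.

Lemma enorm0 : enorm (0 : 'rV[R]_d) = 0.
Proof. by rewrite /enorm big1 ?sqrtr0// => j _; rewrite mxE expr0n. Qed.

Lemma enormZ (c : R) u : enorm (c *: u) = `|c| * enorm u.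
Proof.
rewrite /enorm -sqrtr_sqr -sqrtrM ?sqr_ge0// mulr_sumr; congr Num.sqrt.
by apply: eq_bigr => j _; rewrite mxE exprMn.
Qed.

Lemma enormN u : enorm (- u) = enorm u.
Proof. by rewrite -scaleN1r enormZ normrN1 mul1r. Qed.

Lemma sqr_enormD u v :
  enorm (u + v) ^+ 2 =
  enorm u ^+ 2 + enorm v ^+ 2 + 2 * \sum_j u ord0 j * v ord0 j.
Proof.
rewrite !sqr_enorm mulr_sumr -!big_split /=.
by apply: eq_bigr => j _; rewrite mxE; ring.
Qed.

(** Cauchy-Schwarz: with [p = |u| |v|] and [D] the inner product, the squared norm of
    [|v| u - |u| v] is [2 p (p - D)]. *)
Lemma dot_le_enorm u v : \sum_j u ord0 j * v ord0 j <= enorm u * enorm v.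
Proof.
have [u0|u0] := eqVneq (enorm u) 0.
  by rewrite u0 mul0r (enorm0_eq0 u0) big1// => j _; rewrite mxE mul0r.
have [v0|v0] := eqVneq (enorm v) 0.
  by rewrite v0 mulr0 (enorm0_eq0 v0) big1// => j _; rewrite mxE mulr0.
have ugt0 : 0 < enorm u by rewrite lt_neqAle eq_sym u0 enorm_ge0.
have vgt0 : 0 < enorm v by rewrite lt_neqAle eq_sym v0 enorm_ge0.
have := sqr_ge0 (enorm (enorm v *: u + (- enorm u) *: v)).
rewrite sqr_enormD !enormZ normrN !ger0_norm ?enorm_ge0//.
under eq_bigr => j _ do rewrite 2!mxE.
rewrite (eq_bigr (fun j => (- (enorm u * enorm v)) * (u ord0 j * v ord0 j))) => [|j _].
  rewrite -mulr_sumr; set D := \sum_j _.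
  have : 0 < enorm u * enorm v by rewrite mulr_gt0.
  set p := enorm u * enorm v => p0.
  rewrite (_ : _ + _ = 2 * p * (p - D)); last by rewrite /p; ring.
  by rewrite pmulr_rge0 ?subr_ge0// mulr_gt0.
by ring.
Qed.

Lemma ler_enormD u v : enorm (u + v) <= enorm u + enorm v.
Proof.
rewrite -(@ler_pXn2r _ 2) ?nnegrE ?addr_ge0 ?enorm_ge0//.
by rewrite sqr_enormD; have := dot_le_enorm u v; nra.
Qed.

Lemma ler_enormB u v : enorm (u - v) <= enorm u + enorm v.
Proof. by rewrite -(enormN v) ler_enormD. Qed.

Lemma ler_dist_enorm u v : `|enorm u - enorm v| <= enorm (u - v).
Proof.
have sub_le (a b : 'rV[R]_d) : enorm a - enorm b <= enorm (a - b).
  by rewrite lerBlDr -{1}(subrK b a) ler_enormD.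
by rewrite ler_norml sub_le andbT lerNl opprB -[enorm (u - v)]enormN opprB sub_le.
Qed.

Lemma ler_enorm_sum (I : finType) (F : I -> 'rV[R]_d) :
  enorm (\sum_i F i) <= \sum_i enorm (F i).
Proof.
elim/big_ind2 : _ => [|u a v b ua vb|i _]; rewrite ?enorm0//.
by rewrite (le_trans (ler_enormD _ _))// lerD.
Qed.

Lemma continuous_enorm : continuous (@enorm R d).
Proof.
move=> u; apply: (@continuous_comp _ _ _ (fun v => \sum_j v ord0 j ^+ 2) (@Num.sqrt R));
  last exact: sqrt_continuous.
apply: (continuous_big (op := +%R) (@add_continuous R)) => j _ v.
apply: (@continuous_comp _ _ _ (fun v => v ord0 j) (fun y : R => y ^+ 2)).
  exact: coord_continuous.
exact: exprn_continuous.
Qed.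

End EuclideanNorm.

(** * Second moment and tail of a centred walk *)

Section EuclideanWalk.
Variables (R : realType) (d : nat) (I : finType) (X : I -> 'rV[R]_d).
Hypothesis I0 : (0 < #|I|)%N.
Hypothesis X_sum : \sum_i X i = 0.
Variable M : R.
Hypothesis M_gt0 : 0 < M.
Hypothesis X_le : forall i, enorm (X i) <= M.
Hypothesis XB_le : forall i j, enorm (X i - X j) <= M.

Let cardI_gt0 : 0 < #|I|%:R :> R. Proof. by rewrite ltr0n. Qed.

(** The increments sum to zero, so the cross term averages out. The bound keeps the form
    [a |.|^2 + b] and can be iterated. *)
Lemma step_sqr_enorm_le (a b : R) w : 0 <= a ->
  step X (fun z => a * enorm z ^+ 2 + b) w <=
  a * enorm w ^+ 2 + (b + a * M ^+ 2).
Proof.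
move=> a0; rewrite /step mulrC ler_pdivrMr//.
rewrite (eq_bigr (fun i => (a * enorm w ^+ 2 + b) + a * enorm (X i) ^+ 2
    + 2 * a * \sum_j w ord0 j * X i ord0 j)) => [|i _]; last first.
  by rewrite sqr_enormD; ring.
rewrite big_split /= -[X in _ + X]mulr_sumr exchange_big /= [X in _ + _ * X]big1 => [|j _].
  rewrite mulr0 addr0 mulr_natr -sumr_const ler_sum// => i _.
  rewrite [leRHS]addrA lerD2l ler_wpM2l// lerXn2r ?nnegrE ?enorm_ge0//.
  by rewrite ltW.
rewrite -mulr_sumr (_ : \sum_i X i ord0 j = 0) ?mulr0//.
by rewrite -(summxE _ _ (fun i => X i)) X_sum mxE.
Qed.

Lemma iter_step_sqr_enorm_le m (a b : R) w : 0 <= a ->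
  iter m (step X) (fun z => a * enorm z ^+ 2 + b) w <=
  a * enorm w ^+ 2 + (b + m%:R * (a * M ^+ 2)).
Proof.
move=> a0; elim: m b => [|m IH] b; first by rewrite mul0r addr0.
rewrite iterSr.
apply: le_trans (ler_iter_step X m (fun z => step_sqr_enorm_le b z a0) w) _.
by rewrite (le_trans (IH _))// -natr1 mulrDl mul1r -addrA [a * M ^+ 2 + _]addrC.
Qed.

(* AM-GM linearizes the square root: |z| <= |z|^2 / (2 r) + r / 2, where the
   second moment of |z| after m steps is at most r^2. *)
Lemma iter_step_enorm_le m : (0 < m)%N ->
  iter m (step X) (@enorm R d) 0 <= M * Num.sqrt m%:R.
Proof.
move=> m0; set r := M * _.
have r0 : 0 < r by rewrite mulr_gt0// sqrtr_gt0 ltr0n.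
have r2 : m%:R * M ^+ 2 = r ^+ 2 by rewrite exprMn sqr_sqrtr ?ler0n// mulrC.
have amgm (z : 'rV[R]_d) : enorm z <= (2 * r)^-1 * enorm z ^+ 2 + r / 2.
  rewrite -subr_ge0 (_ : _ - _ = (2 * r)^-1 * (enorm z - r) ^+ 2).
    by rewrite mulr_ge0 ?sqr_ge0// invr_ge0 mulr_ge0// ltW.
  by field; rewrite gt_eqF.
apply: le_trans (ler_iter_step X m amgm 0) _.
have a0 : 0 <= (2 * r)^-1 by rewrite invr_ge0 mulr_ge0// ltW.
apply: le_trans (iter_step_sqr_enorm_le _ _ _ a0) _.
rewrite enorm0 expr0n/= mulr0 add0r mulrCA r2 le_eqVlt; apply/orP; left; apply/eqP.
by field; rewrite gt_eqF.
Qed.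

Lemma walk_tail m (a : R) : (0 < m)%N -> 0 <= a ->
  (#|I| ^ m)%:R^-1 * \sum_(s : {ffun 'I_m -> I})
    (M * Num.sqrt m%:R * (1 + 2 * a) < enorm (\sum_k X (s k)))%R%:R <=
  expR (- a ^+ 2).
Proof.
move=> m0 a0; set r := M * _.
have r0 : 0 < r by rewrite mulr_gt0// sqrtr_gt0 ltr0n.
have r2 : m%:R * M ^+ 2 = r ^+ 2 by rewrite exprMn sqr_sqrtr ?ler0n// mulrC.
have lam0 : 0 <= a / r by rewrite divr_ge0// ltW.
pose phi (z : 'rV[R]_d) := a / r * enorm z.
have osc : oscillation_le X (a / r * M) phi.
  move=> w i j; rewrite /phi -mulrBr normrM ger0_norm// ler_wpM2l//.
  by rewrite (le_trans (ler_dist_enorm _ _))// [w + _]addrC addrKA.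
pose ind (z : 'rV[R]_d) : R := (r * (1 + 2 * a) < enorm z)%R%:R.
rewrite (eq_bigr (fun s : {ffun _ -> _} => ind (0 + \sum_k X (s k)))); last first.
  by move=> s _; rewrite add0r.
rewrite walk_avgE//.
have markov z : ind z <= expR (- (a * (1 + 2 * a))) * expR (phi z).
  rewrite -expRD /ind; case: ltP => [lt|_]; last exact: expR_ge0.
  rewrite -[leLHS]expR0 ler_expR addrC subr_ge0.
  apply: le_trans (ler_wpM2l lam0 (ltW lt)).
  by rewrite mulrA divfK ?gt_eqF.
apply: le_trans (ler_iter_step X m markov 0) _.
rewrite (iter_stepZ _ _ _ (expR \o phi)) /=.
(* The exponents are [- a (1 + 2 a)] from Markov's inequality, [m (a M / r)^2 = a^2] from the
   oscillation and at most [(a / r) r = a] from the mean norm; their sum is at most [- a^2]. *)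
have exp_le := iter_step_expR_le I0 m 0 osc.
rewrite (le_trans (ler_wpM2l (expR_ge0 _) exp_le))// -!expRD ler_expR.
rewrite (iter_stepZ _ _ _ (@enorm R d)) /=.
have := ler_wpM2l lam0 (iter_step_enorm_le m0); rewrite -/r divfK ?gt_eqF//.
rewrite exprMn mulrCA r2 expr_div_n divfK ?expf_neq0 ?gt_eqF// => le_a.
by set q := _ * iter _ _ _ _ in le_a *; lra.
Qed.
End EuclideanWalk.

(** * Concentration of the sample mean at a fixed point *)

Lemma sample_mean_concentration (R : realType) (d n m : nat)
    (v : 'I_n -> 'rV[R]_d) (L delta eps : R) :
  (0 < n)%N -> (forall i, enorm (v i) <= L) -> 0 < delta < 1 -> 0 < eps ->
  4 * L ^+ 2 * (1 + 2 * Num.sqrt (ln (1 / delta))) ^+ 2 / eps ^+ 2 <= m%:R ->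
  1 - delta <= (n ^ m)%:R^-1 * \sum_(s : {ffun 'I_m -> 'I_n})
    (enorm (m%:R^-1 *: \sum_k v (s k) - n%:R^-1 *: \sum_i v i) <= eps)%R%:R.
Proof.
move=> n0 v_le /andP[delta0 delta1] eps0 m_ge.
set mu := n%:R^-1 *: _.
have sum1 : (n ^ m)%:R^-1 * (\sum_(s : {ffun 'I_m -> 'I_n}) 1) = 1 :> R.
  rewrite sumr_const card_ffun !card_ord mulVf// pnatr_eq0 -lt0n expn_gt0.
  by rewrite n0.
have L_ge0 : 0 <= L := le_trans (enorm_ge0 _) (v_le (Ordinal n0)).
(* [walk_tail] needs [M > 0]; if [L] is 0, all vectors vanish and the deviation is 0 whatever [m]
   is. *)
have [L0|L_neq0] := eqVneq L 0.
  have v0 i : v i = 0.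
    by apply: enorm0_eq0; apply/le_anti; rewrite enorm_ge0 -L0 v_le.
  rewrite (eq_bigr (fun=> 1)) => [|s _]; first by rewrite sum1 lerBlDl lerDr ltW.
  by rewrite /mu !big1// !scaler0 subr0 enorm0 ltW.
have L_gt0 : 0 < L by rewrite lt_neqAle eq_sym L_neq0.
have nR0 : 0 < n%:R :> R by rewrite ltr0n.
set a := Num.sqrt _ in m_ge.
have a0 : 0 <= a by exact: sqrtr_ge0.
have expa : expR (- a ^+ 2) = delta.
  rewrite sqr_sqrtr; last by rewrite ln_ge0// ler_pdivlMr// mul1r ltW.
  by rewrite div1r lnV ?posrE// opprK lnK.
(* For [L > 0] the required sample size is positive, which rules out the empty sample. *)
have mR0 : 0 < m%:R :> R.
  apply: lt_le_trans m_ge.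
  by rewrite divr_gt0 ?exprn_gt0// !mulr_gt0 ?exprn_gt0// ltr_wpDr// mulr_ge0.
pose X i := v i - mu.
have X_sum : \sum_i X i = 0.
  rewrite sumrB sumr_const card_ord -[mu *+ n]scaler_nat /mu scalerA mulfV ?gt_eqF//.
  by rewrite scale1r subrr.
have mu_le : enorm mu <= L.
  rewrite enormZ ger0_norm ?invr_ge0// mulrC ler_pdivrMr//.
  apply: le_trans (ler_enorm_sum _) _.
  by rewrite -[n in n%:R]card_ord mulr_natr -sumr_const ler_sum.
have X_le i : enorm (X i) <= 2 * L.
  by rewrite (le_trans (ler_enormB _ _))// mulr2n mulrDl !mul1r lerD.
(* The mean cancels in [X i - X j = v i - v j], so the bound is [2 L] again rather than [4 L]. *)
have XB_le i j : enorm (X i - X j) <= 2 * L.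
  rewrite /X opprB addrA subrK.
  by rewrite (le_trans (ler_enormB _ _))// mulr2n mulrDl !mul1r lerD.
have I0 : (0 < #|'I_n|)%N by rewrite card_ord.
have M0 : 0 < 2 * L by rewrite mulr_gt0.
have := walk_tail I0 X_sum M0 X_le XB_le (m := m) _ a0.
rewrite expa card_ord -(ltr0n R) => /(_ mR0) tail.
(* The square root of the sample-size condition; multiplied by [sqrt m], it puts the threshold of
   [walk_tail] at most at [m eps]. *)
have sqrt_m_ge : 2 * L * (1 + 2 * a) <= Num.sqrt m%:R * eps.
  rewrite -(@ler_pXn2r _ 2) ?nnegrE ?mulr_ge0 ?addr_ge0 ?mulr_ge0 ?sqrtr_ge0 ?(ltW eps0)//.
  rewrite [leRHS]exprMn sqr_sqrtr ?ler0n// -ler_pdivrMr ?exprn_gt0//.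
  by apply: le_trans m_ge; rewrite !exprMn -natrX.
have thr : 2 * L * Num.sqrt m%:R * (1 + 2 * a) <= m%:R * eps.
  rewrite -[X in _ <= X * _]sqr_sqrtr ?ler0n// expr2.
  by rewrite [2 * L * _]mulrC -[leLHS]mulrA -[leRHS]mulrA ler_wpM2l ?sqrtr_ge0.
(* Pass to the complement: for every [s] the indicators of small deviation and of the tail event sum
   to at least 1. *)
rewrite lerBlDr -lerBlDl; apply: le_trans tail; rewrite lerBlDr -[leLHS]sum1.
rewrite -mulrDr -big_split /= ler_wpM2l ?invr_ge0 ?ler0n// ler_sum// => s _.
case: (leP (enorm _) eps) => [_|gt]; first by rewrite lerDr ler0n.
suff -> : 2 * L * Num.sqrt m%:R * (1 + 2 * a) < enorm (\sum_k X (s k)).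
  by rewrite lerDl.
apply: le_lt_trans thr _.
rewrite -(ltr_pM2l mR0) in gt; apply: lt_le_trans gt _.
rewrite -[X in X * _](ger0_norm (ltW mR0)) -enormZ scalerBr scalerA mulfV ?gt_eqF//.
by rewrite scale1r /X sumrB sumr_const card_ord scaler_nat.
Qed.

(** * Gradients of Lipschitz functions and of averages *)

Section Gradient.
Variables (R : realType) (d : nat).
Implicit Types (f : 'rV[R]_d -> R) (x v : 'rV[R]_d).

(** Difference quotients obey the bound, a closed condition, so it passes to the limit. In dimension
    0 the Lipschitz condition admits a negative [L], hence [|L|]. *)
Lemma derive_le_elipschitz L f x v : elipschitz L f -> derivable f x v ->
  `|'D_v f x| <= `|L| * enorm v.
Proof.
move=> lip df.
apply: (@closed_cvg _ _ _ _ _ (fun y : R => `|y| <= `|L| * enorm v) _ _ _ df).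
  apply: (@preimage_closed _ _ (fun y : R => `|y|) [set y | y <= `|L| * enorm v]).
    by move=> y _; exact: norm_continuous.
  exact: closed_le.
near=> h.
have h0 : h != 0 by near: h; exact: nbhs_dnbhs_neq.
rewrite /= normrZ normfV ler_pdivrMl ?normr_gt0//.
apply: le_trans (lip _ _) _.
by rewrite addrK enormZ mulrCA ler_wpM2l// ler_wpM2r ?enorm_ge0 ?ler_norm//.
Unshelve. all: by end_near. Qed.

Lemma derive_gradE f x v : differentiable f x ->
  'D_v f x = \sum_j v ord0 j * grad f x ord0 j.
Proof.
move=> df; rewrite deriveE// {1}(row_sum_delta v) linear_sum/=.
by apply: eq_bigr => j _; rewrite linearZ mxE deriveE.
Qed.

(** In the direction [g = grad f x] the derivative is [|g|^2], and it is at most [|L| |g|]; divide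
    by [|g|]. *)
Lemma enorm_grad_le L f x : elipschitz L f -> differentiable f x ->
  enorm (grad f x) <= `|L|.
Proof.
move=> lip df; have := derive_le_elipschitz lip (diff_derivable (v := grad f x) df).
rewrite derive_gradE// (eq_bigr (fun j => grad f x ord0 j ^+ 2)) => [|j _]; last first.
  by rewrite expr2.
rewrite -sqr_enorm ger0_norm ?sqr_ge0// expr2.
have [->|g0] := eqVneq (enorm (grad f x)) 0; first by rewrite normr_ge0.
by rewrite ler_pM2r// lt_neqAle eq_sym g0 enorm_ge0.
Qed.

Lemma grad_average n (f : 'I_n -> 'rV[R]_d -> R) x :
  (forall i, differentiable (f i) x) ->
  grad (average f) x = n%:R^-1 *: \sum_i grad (f i) x.
Proof.
move=> df; apply/rowP => j; rewrite !mxE summxE.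
rewrite (_ : average f = n%:R^-1 *: \sum_i f i); last first.
  by rewrite fct_sumE; apply/funext.
have dfj i : derivable (f i) x (delta_mx ord0 j) by exact: diff_derivable.
rewrite deriveZ ?derive_sum//; last exact: derivable_sum.
by congr (_ *: _); apply: eq_bigr => i _; rewrite mxE.
Qed.

End Gradient.

(** * Closed sets and Borel sets *)

Lemma closed_enorm_le (R : realType) (V : topologicalType) (d : nat)
    (g : V -> 'rV[R]_d) (c : R) :
  continuous g -> closed [set y | enorm (g y) <= c].
Proof.
move=> cg; apply: (@preimage_closed _ _ (@enorm R d \o g) [set y | y <= c]).
  by move=> y _; apply: continuous_comp; [exact: cg|exact: continuous_enorm].
exact: closed_le.
Qed.

Lemma closed_borel (R : realType) (d : nat) (A : set 'rV[R]_d) :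
  closed A -> borel R d A.
Proof.
move=> cA; rewrite -[A]setCK -setTD.
have [_ sC _] := smallest_sigma_algebra [set: 'rV[R]_d] open.
by apply: sC; apply: sub_sigma_algebra; exact: closed_openC.
Qed.

(** * Conditioning on the draws *)

Section Probability.
Context {dT : measure_display} {T : measurableType dT} {R : realType}.
Variable P : probability T R.

(** Integrate the pointwise inequality against [P] and exchange the finite sum with the integral. *)
Lemma weighted_probability_ge (J : finType) (A : J -> set T) (c p : R) :
  (forall j, measurable (A j)) -> 0 <= c -> 0 <= p ->
  (forall w, c <= p * \sum_j \1_(A j) w) ->
  (c%:E <= \sum_j p%:E * P (A j))%E.
Proof.
move=> mA c0 p0 le.
have mI j : measurable_fun [set: T] (EFin \o (\1_(A j) : T -> R)).
  by apply/measurable_EFinP; exact: measurable_indic.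
have I0 j w : (0 <= (\1_(A j) w : R)%:E)%E by rewrite lee_fin.
rewrite (eq_bigr (fun j => \int[P]_w (p%:E * (\1_(A j) w)%:E))%E) => [|j _]; last first.
  rewrite ge0_integralZl ?lee_fin//; first by rewrite integral_indic// setIT.
  exact: mI.
rewrite -ge0_integral_sum//; last 2 first.
- by move=> j; apply: measurable_funeM; exact: mI.
- by move=> j w _; rewrite mule_ge0 ?lee_fin.
have <- : (\int[P]_w (cst c%:E) w)%E = c%:E.
  by rewrite integral_cst// [X in (_ * X)%E](@probability_setT _ _ _ P) mule1.
apply: ge0_le_integral => //.
- by apply: emeasurable_sum => j; apply: measurable_funeM; exact: mI.
move=> w _ /=; under eq_bigr do rewrite -EFinM.
by rewrite sumEFin lee_fin -mulr_sumr.
Qed.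

Variables (d n m : nat) (S : 'I_m -> T -> 'I_n) (x : T -> 'rV[R]_d).
Hypothesis hS : uniform_sample P S x.

Let draws w : {ffun 'I_m -> 'I_n} := [ffun k => S k w].

Lemma preimage_drawsE s :
  draws @^-1` [set s] = \bigcap_(k in [set: 'I_m]) S k @^-1` [set s k].
Proof.
apply/seteqP; split => [w /= <- k _ /=|w sE /=]; first by rewrite ffunE.
by apply/ffunP => k; rewrite ffunE; exact: sE.
Qed.

Lemma measurable_draws s : measurable (draws @^-1` [set s]).
Proof.
have [mS _ _ _] := hS; rewrite preimage_drawsE.
by apply: fin_bigcap_measurable => // k _; exact: mS.
Qed.

Lemma probability_draws s : P (draws @^-1` [set s]) = ((n ^ m)%:R^-1)%:E.
Proof.
have [_ uS iS _] := hS; rewrite preimage_drawsE.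
have Es k : k \in [set: 'I_m]%SET ->
    sigma_of discrete_measurable (S k) (S k @^-1` [set s k]).
  by exists [set s k]; rewrite ?setTI.
have := iS _ _ Es.
rewrite (_ : [set` _] = [set: 'I_m]); last first.
  by apply/seteqP; split => // k _; rewrite /= finset.in_setT.
move=> ->.
rewrite (eq_bigr (fun=> (n%:R^-1)%:E)) => [|k _]; last exact: uS.
rewrite prodEFin prodr_const cardsT card_ord.
by rewrite natrX exprVn.
Qed.

(** Split by the value of the draws: independence from [x] factors each piece, and every sequence
    has probability [n^(-m)]. Only the iterate remains random. *)
Lemma uniform_sample_probability (B : {ffun 'I_m -> 'I_n} -> set 'rV[R]_d) :
  random_element (borel R d) x -> (forall s, borel R d (B s)) ->
  P [set w | B (draws w) (x w)] =
  (\sum_s ((n ^ m)%:R^-1)%:E * P (x @^-1` B s))%E.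
Proof.
move=> mx bB; have [_ _ _ iSx] := hS.
pose E s := draws @^-1` [set s] `&` x @^-1` B s.
have -> : [set w | B (draws w) (x w)] =
    \big[setU/set0]_(s <- index_enum {ffun 'I_m -> 'I_n}) E s.
  rewrite -bigcup_seq; apply/seteqP; split => [w Bw|w [s _ [/= <-]]//].
  by exists (draws w) => //=; rewrite mem_index_enum.
rewrite -bigcup_seq measure_fin_bigcup//=; last 2 first.
- by move=> s t _ _ [w [[<- _] [<- _]]].
- by move=> s _; apply: measurableI; [exact: measurable_draws|exact: mx].
rewrite -fsbig_seq ?index_enum_uniq//.
apply: eq_bigr => s _; rewrite -(probability_draws s).
apply: iSx; first by exists [set s]; rewrite ?setTI.
by exists (B s); rewrite ?setTI.
Qed.

End Probability.

(** * The sampling guarantee at a random iterate *)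

Theorem theorem1 (R : realType) (dT : measure_display) (T : measurableType dT)
    (P : probability T R) (d n : nat) (hn : (0 < n)%N)
    (f : 'I_n -> 'rV[R]_d -> R) (L0 delta eps : R)
    (hf : forall i, twice_differentiable (f i))
    (hL : forall i, elipschitz L0 (f i))
    (hdelta : 0 < delta < 1) (heps : 0 < eps)
    (x : nat -> T -> 'rV[R]_d)
    (hx : forall t, random_element (borel R d) (x t))
    (m : nat -> nat) (S : forall t : nat, 'I_(m t) -> T -> 'I_n)
    (hS : forall t, uniform_sample P (S t) (x t))
    (hm : forall t,
      4 * L0 ^+ 2 * (1 + 2 * Num.sqrt (ln (1 / delta))) ^+ 2 / eps ^+ 2
        <= (m t)%:R) :
  forall t,
    ((1 - delta)%:E <=
     P [set w | (enorm (subsampled_grad f (fun k => S t k w) (x t w)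
                        - grad (average f) (x t w)) <= eps)%R])%E.
Proof.
move=> t; have /andP[delta0 delta1] := hdelta.
have df i y : differentiable (f i) y := (hf i).1 y.
pose B (s : {ffun 'I_(m t) -> 'I_n}) := [set y |
  enorm (subsampled_grad f s y - grad (average f) y) <= eps].
rewrite (_ : [set w | _] = [set w | B [ffun k => S t k w] (x t w)]); last first.
  rewrite /B /subsampled_grad; apply: eq_set => w /=.
  by under [in RHS]eq_bigr do rewrite ffunE.
(* The gradient maps are differentiable, hence continuous, so [B s] is closed. *)
have B_borel s : borel R d (B s).
  apply: closed_borel; apply: closed_enorm_le => y.
  (* A general index family serves both the sampled mean and, with [id], the full average. *)
  have avg_cont k (h : 'I_k -> 'I_n) :
      continuous (fun z => k%:R^-1 *: \sum_(j < k) grad (f (h j)) z).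
    move=> z; apply: continuous_comp; last exact: scaler_continuous.
    apply: (continuous_big (op := +%R) (@add_continuous _)) => j _ u.
    exact: differentiable_continuous ((hf (h j)).2 u).
  apply: continuousB; first exact: avg_cont.
  rewrite (_ : grad (average f) = fun z => n%:R^-1 *: \sum_i grad (f i) z).
    exact: (avg_cont n id).
  by apply/funext => z; exact: grad_average.
rewrite (uniform_sample_probability (hS t))//.
(* The roles are exchanged: at each outcome [w] the iterate is a fixed point and [s] ranges over all
   samples. *)
apply: weighted_probability_ge => [s||| w].
- exact: hx.
- by rewrite subr_ge0 ltW.
- by rewrite invr_ge0.
have grad_le i : enorm (grad (f i) (x t w)) <= `|L0| by exact: enorm_grad_le.
have := sample_mean_concentration (m := m t) hn grad_le hdelta heps.
(* The gradients are bounded by [|L0|], whose square is the [L0^2] of the sample-size condition. *)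
rewrite real_normK ?num_real// => /(_ (hm t)) /le_trans; apply.
rewrite ler_wpM2l ?invr_ge0// ler_sum// => s _.
rewrite indicE -(@grad_average _ _ _ f)//; case: (leP (enorm _) eps) => // le.
by rewrite mem_set.
Qed.
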